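(* For every integer $n>1$, the centipede graph $P_n\circ K_1$ is a $G_\phi$-graph.
   Context: $\phi$ denotes Euler's totient function, $\phi^0(n)=n$ and $\phi^i(n)=\phi(\phi^{i-1}(n))$. For a set $A$ of positive integers, $A_\phi=\{\phi^k(n): n\in A,\ k\ge 0\}$, and $G_\phi(A)$ is the simple graph with vertex set $A_\phi$ in which distinct vertices $r,s$ are adjacent iff $\phi(r)=s$ or $\phi(s)=r$. A graph $H$ is a $G_\phi$-graph if there exists a set $A$ of positive integers such that $H$ is (isomorphic to) $G_\phi(A)$. $P_n\circ K_1$ is the graph obtained from the path $P_n$ on $n$ vertices by attaching, to each vertex $v$ of the path, a new vertex $v'$ via a pendant edge $vv'$. *)

(* Defs.v *)
From mathcomp Require Import all_boot.
From mathcomp Require Import boolp classical_sets.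

Set Implicit Arguments.
Unset Strict Implicit.
Unset Printing Implicit Defensive.

Local Open Scope classical_set_scope.

(* Vertex types are arbitrary, possibly infinite: the graph of an infinite set
   of integers must be allowed. *)
Record sgraph := SGraph {
  vertex :> Type;
  adj : vertex -> vertex -> Prop;
  adj_sym : forall x y, adj x y -> adj y x;
  adj_irrefl : forall x, ~ adj x x
}.

Definition isomorphic (G H : sgraph) : Prop :=
  exists2 f : G -> H, bijective f & forall x y, adj x y <-> adj (f x) (f y).

Definition phi_closure (A : set nat) : set nat :=
  [set m | exists2 n, A n & exists k, m = iter k totient n].

Section PhiGraph.
Variable A : set nat.

Definition phi_adj (r s : phi_closure A) : Prop :=
  r <> s /\ (totient (val r) = val s \/ totient (val s) = val r).

Lemma phi_adj_sym r s : phi_adj r s -> phi_adj s r.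
Proof. by case=> nrs [] e; split; auto. Qed.

Lemma phi_adj_irrefl r : ~ phi_adj r r.
Proof. by case. Qed.

Definition phi_graph : sgraph := SGraph phi_adj_sym phi_adj_irrefl.

End PhiGraph.

Definition is_phi_graph (H : sgraph) : Prop :=
  exists2 A : set nat, (forall n, A n -> 0 < n) & isomorphic H (phi_graph A).

Section PathGraph.
Variable n : nat.

Definition path_adj (i j : 'I_n) : Prop := i.+1 = j \/ j.+1 = i.

Lemma path_adj_sym i j : path_adj i j -> path_adj j i.
Proof. by case; [right | left]. Qed.

Lemma path_adj_irrefl i : ~ path_adj i i.
Proof. by case=> /eqP; rewrite eqn_leq ltnn. Qed.

Definition path_graph : sgraph := SGraph path_adj_sym path_adj_irrefl.

End PathGraph.

(* The corona of G with K_1: [inl v] is the vertex v of G, [inr v] is the new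
   vertex v' whose only neighbour is v. *)
Section CoronaK1.
Variable G : sgraph.

Definition corona_K1_adj (x y : G + G) : Prop :=
  match x, y with
  | inl u, inl v => adj u v
  | inl u, inr v => u = v
  | inr u, inl v => u = v
  | inr _, inr _ => False
  end.

Lemma corona_K1_adj_sym x y : corona_K1_adj x y -> corona_K1_adj y x.
Proof. by case: x y => [u|u] [v|v] //=; apply: adj_sym. Qed.

Lemma corona_K1_adj_irrefl x : ~ corona_K1_adj x x.
Proof. by case: x => [u|u] //=; apply: adj_irrefl. Qed.

Definition corona_K1 : sgraph := SGraph corona_K1_adj_sym corona_K1_adj_irrefl.

End CoronaK1.

Definition centipede (n : nat) : sgraph := corona_K1 (path_graph n).

(* Main.v *)
Require Import Defs.
From mathcomp Require Import all_boot.
From mathcomp Require Import boolp classical_sets.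

(** For i > 0, phi sends both 2 * 3^i and 3^i to 2 * 3^(i-1). So the numbers
    2 * 3^i with i < n form the spine of a centipede, the leaf at 2 * 3^i being
    3^(i+1), except that the leaf at 2 has to be 1, which lies in every nonempty
    closure under phi; hence 3 is left out. *)

(** A range closed under [totient] is its own [phi_closure], so with [range c] as [A] the map [c]
    reaches every vertex and is itself the isomorphism. *)
Lemma is_phi_graph_of_labelling (H : sgraph) (c : H -> nat) :
    injective c -> (forall x, 0 < c x) ->
    (forall x, exists y, totient (c x) = c y) ->
    (forall x y, adj x y <->
       c x <> c y /\ (totient (c x) = c y \/ totient (c y) = c x)) ->
  is_phi_graph H.
Proof.
move=> c_inj c_gt0 c_tot c_adj; pose A := range c.
exists A => [_ [x _ <-] //|].
have cA x : c x \in phi_closure A.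
  by apply: mem_set; exists (c x); [exists x | exists 0].
have Ac (r : phi_closure A) : exists x, c x = val r.
  have [_ [x _ <-] [k ->]] := set_mem (valP r).
  elim: k => [|k [y /= <-]]; first by exists x.
  by have [z ->] := c_tot y; exists z.
have [g gK] := choice Ac.
pose f x : phi_closure A := Sub (c x) (cA x).
exists f => [|x y].
  by exists g => [x | r]; [apply: c_inj; rewrite gK | apply: val_inj; rewrite /= gK].
rewrite c_adj; split=> -[ne e]; split=> // eq_c; apply: ne.
  exact: (congr1 val eq_c).
exact: val_inj.
Qed.

(** Indices are plain naturals, which keeps bound proofs out of the arithmetic. *)
Definition centipede_label (x : nat + nat) : nat :=
  match x with
  | inl i => 2 * 3 ^ i
  | inr 0 => 1
  | inr i.+1 => 3 ^ i.+2
  end.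

(* The root [inr 0], labelled 1, is its own parent since phi(1) = 1. *)
Definition centipede_parent (x : nat + nat) : nat + nat :=
  match x with
  | inl i.+1 => inl i
  | inr i.+1 => inl i.+1
  | _ => inr 0
  end.

(** Parity separates spine from leaves; on each side exponents of 3 are compared, reading the label
    1 as 3^0. *)
Lemma centipede_label_inj : injective centipede_label.
Proof.
have odd_inr i : odd (centipede_label (inr i)) by case: i => // i; rewrite /= oddX.
have even_inl i : odd (centipede_label (inl i)) = false by rewrite /= oddM.
case=> i [] j e; [| by have := odd_inr j; rewrite -e even_inl |
                    by have := odd_inr i; rewrite e even_inl |].
  by move/eqP: e; rewrite /= eqn_pmul2l // eqn_exp2l // => /eqP ->.
case: i j e => [|i] [|j] // /eqP.
- by rewrite /= -(expn0 3) eqn_exp2l.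
- by rewrite /= -(expn0 3) eqn_exp2l.
- by rewrite /= eqn_exp2l // => /eqP [->].
Qed.

Lemma centipede_label_gt0 x : 0 < centipede_label x.
Proof. by case: x => [i|[|i]] //; [rewrite /= muln_gt0 expn_gt0 | rewrite /centipede_label expn_gt0]. Qed.

(** The coprime factor 2 contributes only phi(2) = 1; index 0 is settled by computation. *)
Lemma totient_centipede_label x :
  totient (centipede_label x) = centipede_label (centipede_parent x).
Proof.
case: x => -[|i] //=; last by rewrite totient_pfactor.
by rewrite totient_coprime ?coprimeXr // totient_pfactor // mul1n.
Qed.

Theorem theorem2p12 (n : nat) (hn : 1 < n) : is_phi_graph (centipede n).
Proof.
pose v (x : centipede n) : nat + nat :=
  match x with inl i => inl (val i) | inr i => inr (val i) end.
have v_inj : injective v by case=> i [] j //= [] /val_inj ->.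
have n_gt0 : 0 < n by apply: ltnW.
apply: (@is_phi_graph_of_labelling _ (centipede_label \o v)).
- exact: inj_comp centipede_label_inj v_inj.
- by move=> x; apply: centipede_label_gt0.
- move=> x; suff [y vy] : exists y, v y = centipede_parent (v x).
    by exists y; rewrite /= totient_centipede_label vy.
  (* Passing to the parent never raises the index, so the bound [n] is kept. *)
  case: x => -[[|i] ltin] /=.
  + by exists (inr (Ordinal n_gt0)).
  + by exists (inl (Ordinal (ltnW ltin))).
  + by exists (inr (Ordinal n_gt0)).
  + by exists (inl (Ordinal ltin)).
move=> x y; rewrite /= !totient_centipede_label.
(* Injectivity removes the labels: adjacency now says that one of two distinct vertices is the
   parent of the other. *)
have labelE a b : (centipede_label a = centipede_label b) <-> a = b.
  by split=> [/centipede_label_inj|->].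
rewrite !labelE.
case: x y => [] [i ltin] [] [j ltjn] /=; rewrite /path_adj /=.
- split=> [[] e|[_ [] e]].
  + by subst j; split=> [[/eqP]|]; [rewrite ltn_eqF | right].
  + by subst i; split=> [[/esym/eqP]|]; [rewrite ltn_eqF | left].
  + by case: i ltin e => [|i] //= _ [->]; right.
  + by case: j ltjn e => [|j] //= _ [->]; left.
(* The pendant edge changes direction at index 0: [inr 0] is the parent of [inl 0], but [inl i.+1]
   is the parent of [inr i.+1]. *)
- split=> [[e]|[_ [] e]].
  + by subst j; split=> //; case: i {ltin ltjn} => [|i]; [left | right].
  + by case: i ltin e => [|i] //= ltin [e]; subst j; apply: val_inj.
  + by case: j ltjn e => [|j] //= ltjn [e]; subst i; apply: val_inj.
- split=> [[e]|[_ [] e]].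
  + by subst j; split=> //; case: i {ltin ltjn} => [|i]; [right | left].
  + by case: i ltin e => [|i] //= ltin [e]; subst j; apply: val_inj.
  + by case: j ltjn e => [|j] //= ltjn [e]; subst i; apply: val_inj.
(* The only leaf whose parent is a leaf is the root [inr 0], its own parent, which [ne] excludes. *)
- split=> // -[ne [] e].
  + by case: i j {ltin ltjn} ne e => [|i] [|j].
  + by case: i j {ltin ltjn} ne e => [|i] [|j].
Qed.
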